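(* Let $U$ be a double algebra consisting of a Grassmann algebra $\Lambda(V)$ (product $\wedge$) and a Clifford algebra $\mathrm{Cl}_V(B)$ (product written by juxtaposition) occupying the same linear space $U$, such that $1_{\mathrm{Cl}(B)}=1_\Lambda$ and such that $V$ is a common linear subspace of the two. Then $U$ is a geometric algebra over $B$ if and only if for all $a_1,\dots,a_p\in V$ the following implication holds: if $a_1,a_2,\dots,a_p$ are pairwise orthogonal (i.e. $B(a_i,a_j)=0$ for $i\ne j$), then $\prod_{i=1}^pa_i=\bigwedge_{i=1}^pa_i$.
   Context: Setting: $R$ is a commutative ring with unit $1\neq 0$; $V\neq\{0\}$ is a free unitary $R$-module with basis $(e_i\mid i\in M)$, where $M$ (possibly infinite) is totally ordered by $<$; $B:V\times V\to R$ is a bilinear form which is diagonal in this basis, i.e. $B(e_i,e_j)=0$ for $i\ne j$; and $q(i)=B(e_i,e_i)$. ''Linear space'' means $R$-module. $\mathcal{F}$ is the set of finite subsets of $M$, and $W=\bigoplus_{\mathcal{F}}R$ is the free $R$-module with basis $(e_K\mid K\in\mathcal{F})$. $V$ is regarded as a submodule of $W$ by identifying $e_i$ with $e_{\{i\}}$. $H\triangle J=(H\cup J)\setminus(H\cap J)$. For $H,J\in\mathcal{F}$: $\alpha(H,J)=\prod(-1)$ over all $(i,j)\in H\times J$ with $j<i$; $\beta(H,J)=\prod_{i\in H\cap J}q(i)$; $\sigma(H,J)=\alpha(H,J)\,\beta(H,J)$ (empty products equal $1$). $W_B=W$ is the associative unital $R$-algebra with unit $e_\emptyset$ whose product is the bilinear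 extension of $e_He_J=\sigma(H,J)\,e_{H\triangle J}$. $W_0$ is the algebra obtained by the same construction on the same module $W$ and basis with the zero bilinear form in place of $B$; its product is written $\wedge$ (outer product). A Clifford algebra over $B$, $\mathrm{Cl}_V(B)$, is an algebra (containing $V$) isomorphic to $W_B$ with an isomorphism fixing $V$. A Grassmann algebra $\Lambda(V)$ is a Clifford algebra over the zero form, i.e. an algebra isomorphic to $W_0$ with an isomorphism fixing $V$. Their units are denoted $1_{\mathrm{Cl}(B)}$ and $1_\Lambda$. A double algebra is a linear space equipped with two algebra products. $W$ with both the product of $W_B$ and the product of $W_0$ is the double algebra $W_{B,0}$. A geometric algebra over $B$, denoted $\Lambda(V,B)$, is a double algebra isomorphic (with respect to both products) to $W_{B,0}$ with an isomorphism fixing $V$. *)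

(* Defs.v *)
From HB Require Import structures.
From mathcomp Require Import all_boot all_order all_algebra.
From mathcomp Require Import finmap monalg.

Set Implicit Arguments.
Unset Strict Implicit.
Unset Printing Implicit Defensive.

Import Order.TTheory GRing.Theory.

Local Open Scope fset_scope.
Local Open Scope ring_scope.

Section Bases.

Variables (R : comNzRingType) (I : choiceType) (V : lmodType R).
Implicit Types (e : I -> V) (c : {malg R[I]}).

Definition lincomb e c : V := \sum_(i <- msupp c) c@_i *: e i.

Lemma lincombEw e c (D : {fset I}) : msupp c `<=` D ->
  lincomb e c = \sum_(i <- D) c@_i *: e i.
Proof.
move=> sD; rewrite /lincomb (big_fset_incl _ sD) // => i _ /mcoeff_outdom ->.
by rewrite scale0r.
Qed.

Lemma lincomb_is_linear e : linear (lincomb e).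
Proof.
move=> a c1 c2; pose D := msupp c1 `|` msupp c2.
have s1 : msupp c1 `<=` D by exact: fsubsetUl.
have s2 : msupp c2 `<=` D by exact: fsubsetUr.
have s3 : msupp (a *: c1 + c2) `<=` D.
  apply: fsubset_trans (msuppD_le _ _) _.
  by rewrite fsubUset s2 andbT (fsubset_trans (msuppZ_le _ _)).
rewrite (lincombEw e s1) (lincombEw e s2) (lincombEw e s3) scaler_sumr.
rewrite -big_split /=; apply: eq_bigr => i _.
by rewrite mcoeffD mcoeffZ scalerDl scalerA.
Qed.

HB.instance Definition _ e :=
  GRing.isLinear.Build R {malg R[I]} V _ (lincomb e) (lincomb_is_linear e).

Lemma lincombU e i : lincomb e << i >> = e i.
Proof. by rewrite (lincombEw e msuppU_le) big_seq_fset1 mcoeffUU scale1r. Qed.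

Record is_basis e : Prop := IsBasis {
  basis_free : forall c, lincomb e c = 0 -> c = 0;
  basis_span : forall x, exists c, lincomb e c = x
}.

Lemma coord_subproof e (he : is_basis e) x : exists c, lincomb e c == x.
Proof. by have [c <-] := basis_span he x; exists c. Qed.

Definition coord e (he : is_basis e) x : {malg R[I]} :=
  xchoose (coord_subproof he x).

Lemma coordK e (he : is_basis e) : cancel (coord he) (lincomb e).
Proof. by move=> x; apply/eqP; exact: (xchooseP (coord_subproof he x)). Qed.

Lemma lincombK e (he : is_basis e) : cancel (lincomb e) (coord he).
Proof.
move=> c; apply/eqP; rewrite -subr_eq0; apply/eqP/(basis_free he).
by rewrite linearB /= coordK subrr.
Qed.

Lemma coord_is_linear e (he : is_basis e) : linear (coord he).
Proof.
by move=> a x y; apply: (can_inj (lincombK he)); rewrite (lincomb_is_linear e) !coordK.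
Qed.

HB.instance Definition _ e (he : is_basis e) :=
  GRing.isLinear.Build R V {malg R[I]} _ (coord he) (coord_is_linear he).

End Bases.

Section ZeroForm.

Variables (R : comNzRingType) (V : lmodType R).

Definition zero_form (x y : V) : R := 0.

Lemma zero_form_is_bilinear : bilinear_for *%R *%R zero_form.
Proof. by split=> u a v w; rewrite /= /zero_form [a * 0]mulr0 addr0. Qed.

HB.instance Definition _ :=
  bilinear_isBilinear.Build R V V R *%R *%R zero_form zero_form_is_bilinear.

End ZeroForm.

(* [algType] allows a single product per carrier, whereas a double algebra
   carries two on the same module; hence this bundle of a unital associative
   [R]-algebra structure over a fixed module. *)
Record algebra_on (R : comNzRingType) (U : lmodType R) := AlgebraOn {
  amul : U -> U -> U;
  aone : U;
  amulA : associative amul;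
  amul1l : left_id aone amul;
  amul1r : right_id aone amul;
  amul_bilinear : bilinear_for *:%R *:%R amul
}.

Record double_algebra (R : comNzRingType) (U : lmodType R) := DoubleAlgebra {
  clifford_part : algebra_on U;
  outer_part : algebra_on U
}.

Section StandardAlgebra.

Variables (R : comNzRingType) (d : Order.disp_t) (M : orderType d).
Variable q : M -> R.
Implicit Types H J K : {fset M}.

Notation W := {malg R[{fset M}]}.

Definition symdiff H J : {fset M} := (H `|` J) `\` (H `&` J).

Definition alpha H J : R := \prod_(i <- H) \prod_(j <- J | (j < i)%O) (-1).

Definition beta H J : R := \prod_(i <- H `&` J) q i.

Definition sigma H J : R := alpha H J * beta H J.

Definition mulW (x y : W) : W :=
  \sum_(H <- msupp x) \sum_(J <- msupp y)
    (x@_H * y@_J * sigma H J) *: << symdiff H J >>.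

Definition oneW : W := << fset0 >>.

Lemma mulWEw (D E : {fset {fset M}}) (x y : W) :
  msupp x `<=` D -> msupp y `<=` E ->
  mulW x y = \sum_(H <- D) \sum_(J <- E)
    (x@_H * y@_J * sigma H J) *: << symdiff H J >>.
Proof.
move=> sD sE; rewrite /mulW (big_fset_incl _ sD) /=; last first.
  move=> H _ /mcoeff_outdom ->.
  by rewrite big1 // => J _; rewrite !mul0r scale0r.
apply: eq_bigr => H _; apply: big_fset_incl => // J _ /mcoeff_outdom ->.
by rewrite mulr0 mul0r scale0r.
Qed.

Lemma mulW_linearl (y : W) : linear (mulW^~ y).
Proof.
move=> a x1 x2; pose D := msupp x1 `|` msupp x2.
have s1 : msupp x1 `<=` D by exact: fsubsetUl.
have s2 : msupp x2 `<=` D by exact: fsubsetUr.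
have s3 : msupp (a *: x1 + x2) `<=` D.
  apply: fsubset_trans (msuppD_le _ _) _.
  by rewrite fsubUset s2 andbT (fsubset_trans (msuppZ_le _ _)).
have sy := fsubset_refl (msupp y).
rewrite (mulWEw s1 sy) (mulWEw s2 sy) (mulWEw s3 sy) scaler_sumr.
rewrite -big_split /=; apply: eq_bigr => H _.
rewrite scaler_sumr -big_split /=; apply: eq_bigr => J _.
by rewrite mcoeffD mcoeffZ !mulrDl scalerDl scalerA !mulrA.
Qed.

Lemma mulW_linearr (x : W) : linear (mulW x).
Proof.
move=> a y1 y2; pose D := msupp y1 `|` msupp y2.
have s1 : msupp y1 `<=` D by exact: fsubsetUl.
have s2 : msupp y2 `<=` D by exact: fsubsetUr.
have s3 : msupp (a *: y1 + y2) `<=` D.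
  apply: fsubset_trans (msuppD_le _ _) _.
  by rewrite fsubUset s2 andbT (fsubset_trans (msuppZ_le _ _)).
have sx := fsubset_refl (msupp x).
rewrite (mulWEw sx s1) (mulWEw sx s2) (mulWEw sx s3) scaler_sumr.
rewrite -big_split /=; apply: eq_bigr => H _.
rewrite scaler_sumr -big_split /=; apply: eq_bigr => J _.
rewrite mcoeffD mcoeffZ mulrDr mulrDl scalerDl scalerA.
by rewrite !mulrA [_ * a]mulrC.
Qed.

Lemma mulW_bilinear : bilinear_for *:%R *:%R mulW.
Proof. by split=> u; [exact: mulW_linearl | exact: mulW_linearr]. Qed.

HB.instance Definition _ :=
  bilinear_isBilinear.Build R W W W *:%R *:%R mulW mulW_bilinear.

Lemma mulWUU H J : mulW << H >> << J >> = sigma H J *: << symdiff H J >>.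
Proof.
by rewrite (mulWEw msuppU_le msuppU_le) !big_seq_fset1 !mcoeffUU !mul1r.
Qed.

Lemma in_symdiff i H J : (i \in symdiff H J) = (i \in H) (+) (i \in J).
Proof. by rewrite !inE; case: (i \in H); case: (i \in J). Qed.

Lemma symdiffA : associative symdiff.
Proof. by move=> H J K; apply/fsetP => i; rewrite !in_symdiff addbA. Qed.

Lemma symdiff0 H : symdiff fset0 H = H.
Proof. by apply/fsetP => i; rewrite in_symdiff in_fset0. Qed.

Lemma symdiffH0 H : symdiff H fset0 = H.
Proof. by apply/fsetP => i; rewrite in_symdiff in_fset0 addbF. Qed.

Lemma prod_fsetU (f : M -> R) H J : [disjoint H & J]%fset ->
  \prod_(i <- H `|` J) f i = (\prod_(i <- H) f i) * \prod_(i <- J) f i.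
Proof.
move=> dHJ; rewrite -big_cat; apply: perm_big; apply: uniq_perm => //.
  rewrite cat_uniq !fset_uniq andbT /=; apply/hasPn => i iJ.
  by apply: contraL iJ => iH; exact: (fdisjointP dHJ).
by move=> i; rewrite mem_cat in_fsetU.
Qed.

Lemma prod_symdiff (f : M -> R) H J : (forall i, f i * f i = 1) ->
  \prod_(i <- symdiff H J) f i = (\prod_(i <- H) f i) * \prod_(i <- J) f i.
Proof.
move=> ff.
have fsplit (A C : {fset M}) : \prod_(i <- A) f i =
    (\prod_(i <- A `\` C) f i) * \prod_(i <- A `&` C) f i.
  rewrite -prod_fsetU.
    congr (\prod_(i <- enum_fset _) _); apply/fsetP => i; rewrite !inE.
    by case: (i \in A); case: (i \in C).
  by apply/fdisjointP => i; rewrite !inE; case: (i \in A); case: (i \in C).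
have -> : symdiff H J = (H `\` J) `|` (J `\` H).
  by apply/fsetP => i; rewrite !inE; case: (i \in H); case: (i \in J).
rewrite (fsplit H J) (fsplit J H) (fsetIC J H) prod_fsetU; last first.
  by apply/fdisjointP => i; rewrite !inE; case: (i \in H); case: (i \in J).
rewrite mulrACA -(big_split _ (H `&` J)) /=.
by rewrite [X in _ = _ * X]big1 ?mulr1.
Qed.

Definition sign_lt (i j : M) : R := if (j < i)%O then -1 else 1.

Lemma sign_ltK i j : sign_lt i j * sign_lt i j = 1.
Proof. by rewrite /sign_lt; case: ifP; rewrite ?mulrNN mulr1. Qed.

Lemma alphaE H J : alpha H J = \prod_(i <- H) \prod_(j <- J) sign_lt i j.
Proof. by apply: eq_bigr => i _; rewrite [LHS]big_mkcond. Qed.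

Lemma alpha_symdiffl H J K : alpha (symdiff H J) K = alpha H K * alpha J K.
Proof.
rewrite !alphaE prod_symdiff // => i.
by rewrite -big_split big1 //= => j _; rewrite sign_ltK.
Qed.

Lemma alpha_symdiffr H J K : alpha H (symdiff J K) = alpha H J * alpha H K.
Proof.
rewrite !alphaE -big_split; apply: eq_bigr => i _.
by rewrite prod_symdiff // => j; rewrite sign_ltK.
Qed.

Lemma beta_cocycle H J K :
  beta H J * beta (symdiff H J) K = beta J K * beta H (symdiff J K).
Proof.
rewrite /beta -!prod_fsetU; last 2 first.
- apply/fdisjointP => i; rewrite !inE.
  by case: (i \in H); case: (i \in J); case: (i \in K).
- apply/fdisjointP => i; rewrite !inE.
  by case: (i \in H); case: (i \in J); case: (i \in K).
congr (\prod_(i <- enum_fset _) _); apply/fsetP => i; rewrite !inE.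
by case: (i \in H); case: (i \in J); case: (i \in K).
Qed.

Lemma sigma_cocycle H J K :
  sigma H J * sigma (symdiff H J) K = sigma J K * sigma H (symdiff J K).
Proof.
rewrite /sigma mulrACA [RHS]mulrACA beta_cocycle; congr (_ * _).
by rewrite alpha_symdiffl alpha_symdiffr mulrA mulrC.
Qed.

Lemma malgUZ H (a : R) : << a *g H >> = a *: << H >> :> W.
Proof. by apply/malgP => J; rewrite mcoeffZ !mcoeffU mulrnAr mulr1. Qed.

Lemma eq_linearW (U : lmodType R) (f g : W -> U) : linear f -> linear g ->
  (forall H, f << H >> = g << H >>) -> f =1 g.
Proof.
move=> lf lg fg x.
pose fL := GRing.isLinear.Build R W U _ f lf.
pose F : {linear W -> U} := HB.pack f fL.
pose gL := GRing.isLinear.Build R W U _ g lg.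
pose G : {linear W -> U} := HB.pack g gL.
rewrite -[f]/(F : W -> U) -[g]/(G : W -> U) [x]monalgE !linear_sum.
by apply: eq_bigr => H _; rewrite malgUZ !linearZ /= fg.
Qed.

Lemma mulWA : associative mulW.
Proof.
have lr := mulW_linearr; have ll := mulW_linearl.
move=> x y z; move: x; apply: eq_linearW => [a u v|a u v|H].
- by rewrite ll.
- by rewrite ll ll.
move: y; apply: eq_linearW => [a u v|a u v|J].
- by rewrite ll lr.
- by rewrite lr ll.
move: z; apply: eq_linearW => [a u v|a u v|K].
- by rewrite lr lr.
- by rewrite lr.
have lZr (x : W) a u : mulW x (a *: u) = a *: mulW x u := linearZr_LR mulW x a u.
have lZl (x : W) a u : mulW (a *: u) x = a *: mulW u x := linearZl_LR mulW x a u.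
by rewrite !mulWUU lZr lZl !mulWUU !scalerA symdiffA sigma_cocycle.
Qed.

Lemma mul1W : left_id oneW mulW.
Proof.
apply: eq_linearW => [||H]; [exact: mulW_linearr | by [] |].
rewrite mulWUU symdiff0 /sigma /alpha /beta fset0I !big_seq_fset0.
by rewrite mulr1 scale1r.
Qed.

Lemma mulW1 : right_id oneW mulW.
Proof.
apply: eq_linearW => [||H]; [exact: mulW_linearl | by [] |].
rewrite mulWUU symdiffH0 /sigma alphaE /beta fsetI0 big_seq_fset0.
by rewrite mulr1 big1 ?scale1r // => i _; rewrite big_seq_fset0.
Qed.

Definition stdW : algebra_on W := AlgebraOn mulWA mul1W mulW1 mulW_bilinear.

End StandardAlgebra.

Section GeometricAlgebra.

Variables (R : comNzRingType) (d : Order.disp_t) (M : orderType d).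
Variables (V : lmodType R) (e : M -> V).

Notation W := {malg R[{fset M}]}.

Definition W_form (B : {biscalar V}) : algebra_on W :=
  stdW (fun i => B (e i) (e i)).

Definition W_zero : algebra_on W := W_form (@zero_form R V).

Definition W_double (B : {biscalar V}) : double_algebra W :=
  DoubleAlgebra (W_form B) W_zero.

Hypothesis he : is_basis e.

Definition V_in_W (v : V) : W := lincomb (fun i => << [fset i] >>) (coord he v).

Lemma V_in_We i : V_in_W (e i) = << [fset i] >>.
Proof. by rewrite /V_in_W -[e i]lincombU lincombK lincombU. Qed.

Lemma V_in_W_is_linear : linear V_in_W.
Proof. by move=> a x y; rewrite /V_in_W !linearP. Qed.

HB.instance Definition _ :=
  GRing.isLinear.Build R V W _ V_in_W V_in_W_is_linear.

Variables (U : lmodType R) (incl : {linear V -> U}).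

Definition algebra_iso (A : algebra_on W) (A' : algebra_on U)
    (f : {linear W -> U}) : Prop :=
  [/\ bijective f, f (aone A) = aone A'
    & {morph f : x y / amul A x y >-> amul A' x y}].

Definition fixes_V (f : {linear W -> U}) : Prop :=
  forall v, f (V_in_W v) = incl v.

Definition is_clifford (B : {biscalar V}) (A : algebra_on U) : Prop :=
  exists2 f : {linear W -> U}, algebra_iso (W_form B) A f & fixes_V f.

Definition is_grassmann (A : algebra_on U) : Prop :=
  is_clifford (@zero_form R V) A.

Definition is_geometric (B : {biscalar V}) (A : double_algebra U) : Prop :=
  exists f : {linear W -> U},
    [/\ algebra_iso (clifford_part (W_double B)) (clifford_part A) f,
        algebra_iso (outer_part (W_double B)) (outer_part A) f
      & fixes_V f].

End GeometricAlgebra.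

Arguments is_clifford {R d M V e} he {U} incl B A.
Arguments is_grassmann {R d M V e} he {U} incl A.
Arguments is_geometric {R d M V e} he {U} incl B A.

Definition aprod (R : comNzRingType) (U : lmodType R) (A : algebra_on U)
    (p : nat) (u : 'I_p -> U) : U := \big[amul A/aone A]_(i < p) u i.

(* Main.v *)
Require Import Defs.
From HB Require Import structures.
From mathcomp Require Import all_boot all_order all_algebra.
From mathcomp Require Import finmap monalg ring.

(** On the module [W], the Clifford product by a vector [v] and the outer
    product by a vector [a] are linked by the single identity

      [v . (a ^ x) + a ^ (v . x) = B(v, a) x]     ([clifford_outer])

    for all [x] in [W].  For diagonal [B] it is checked on basis elements, where
    it comes down to the signs of [alpha].  It packages two classical facts:
    [v . x = v ^ x + i_v x], and the contraction [i_v] is an antiderivation of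
    the outer product with [i_v a = B(v, a)].  For [B = 0] it says that vectors
    anticommute in the outer algebra.

    Hence a vector [v] orthogonal to [a_1, ..., a_p] can be moved through
    [a_1 ^ ... ^ a_p] one factor at a time, changing sign at each step in the
    same way whether it multiplies by the Clifford or by the outer product.
    So [v . (a_1 ^ ... ^ a_p) = v ^ a_1 ^ ... ^ a_p] ([clifford_outer_prod]),
    and by induction the two products of pairwise orthogonal vectors agree in
    [W] ([prod_orthogonal]).  An isomorphism for both products that fixes [V]
    carries this over to [U].

    Conversely, let [f] and [g] be isomorphisms onto the Clifford and the
    Grassmann algebra, both fixing [V].  Every basis element [e_K] of [W] is, up
    to a sign that does not depend on the form, the product of the distinct
    vectors [e_i] with [i] in [K] ([basisE_prod]).  These vectors are pairwise
    orthogonal, so [f] and [g] send [e_K] to two products which agree by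
    hypothesis.  Thus [f = g] is an isomorphism for both products. *)

Set Implicit Arguments.
Unset Strict Implicit.
Unset Printing Implicit Defensive.

Import Order.TTheory GRing.Theory.

Local Open Scope ring_scope.

Section Coefficients.

Variables (R : comNzRingType) (d : Order.disp_t) (M : orderType d).
Implicit Types (q : M -> R) (i j : M) (K : {fset M}).

Notation W := {malg R[{fset M}]}.
Notation vec i := (<< [fset i]%fset >> : W).

Lemma mulWZr q (x y : W) a : mulW q x (a *: y) = a *: mulW q x y.
Proof. exact: (linearZr_LR (mulW q) x a y). Qed.

Lemma alpha1 i K : alpha R [fset i]%fset K = \prod_(j <- K) sign_lt R i j.
Proof. by rewrite alphaE big_seq_fset1. Qed.

Lemma alpha1K i K : alpha R [fset i]%fset K * alpha R [fset i]%fset K = 1.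
Proof.
by rewrite alpha1 -big_split big1 //= => j _; rewrite sign_ltK.
Qed.

Lemma alpha11 i j :
  alpha R [fset i]%fset [fset j]%fset = sign_lt R i j.
Proof. by rewrite alpha1 big_seq_fset1. Qed.

Lemma sign_ltC i j : i != j -> sign_lt R i j = - sign_lt R j i.
Proof. by rewrite /sign_lt; case: ltgtP => //; rewrite opprK. Qed.

Lemma beta1 q i K : beta q [fset i]%fset K = if i \in K then q i else 1.
Proof.
rewrite /beta; case: ifP => iK.
  by rewrite (fsetIidPl _) ?big_seq_fset1 // fsub1set.
rewrite (_ : ([fset i] `&` K)%fset = fset0) ?big_seq_fset0 //.
by apply/fsetP => j; rewrite !inE; case: eqP => // ->.
Qed.

(** Distinct [e_i], [e_j] contribute two terms that differ only by the sign
    exchanging [i] and [j].  When [i = j], exactly one of the two terms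
    survives, according to whether [i] lies in [K], and its sign is a square. *)
Lemma clifford_outer_basis q i j K :
  mulW q (vec i) (mulW (fun=> 0) (vec j) << K >>)
    + mulW (fun=> 0) (vec j) (mulW q (vec i) << K >>)
  = (if i == j then q i else 0) *: << K >>.
Proof.
rewrite !mulWUU !mulWZr !mulWUU !scalerA.
rewrite /sigma !alpha_symdiffr !alpha11 !beta1 !in_symdiff !in_fset1.
case: (eqVneq i j) => [<-|nij].
  rewrite !symdiffA.
  have -> : symdiff [fset i]%fset [fset i]%fset = fset0.
    by apply/fsetP => k; rewrite in_symdiff addbb.
  rewrite symdiff0 -scalerDl; congr (_ *: _).
  rewrite /sign_lt ltxx !mul1r; have aa := alpha1K i K.
  case: (i \in K) => /=.
    by rewrite !mulr0 !mul0r add0r mulr1 mulrAC aa mul1r.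
  by rewrite !mulr0 addr0 mulr1 mulrA aa mul1r.
rewrite scale0r; set K1 := symdiff _ (symdiff _ K); set K2 := symdiff _ _.
have -> : K2 = K1 by apply/fsetP => k; rewrite !in_symdiff addbCA.
rewrite -scalerDl (sign_ltC nij) !addFb.
rewrite (_ : _ + _ = 0) ?scale0r //.
by case: ifP => _; case: ifP => _; ring.
Qed.

(** The sign is uniform in [q]: a product of distinct basis vectors never meets
    a factor [q i]. *)
Lemma basisE_prod (s : seq M) : uniq s -> exists c : R, forall q,
  << [fset i in s]%fset >>
  = c *: \big[mulW q/oneW R M]_(i <- s) vec i :> W.
Proof.
elim: s => [_|i s IHs /= /andP [nis /IHs [c sE]]].
  exists 1 => q; rewrite big_nil scale1r; congr << _ >>.
  by apply/fsetP => j; rewrite !inE.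
pose K := [fset j in s]%fset.
have niK : i \notin K by rewrite !inE.
(* The sign of [e_i e_K] is its own inverse. *)
exists (alpha R [fset i]%fset K * c) => q; rewrite big_cons -scalerA.
rewrite -mulWZr -sE mulWUU scalerA.
rewrite /sigma beta1 (negPf niK) mulr1 alpha1K scale1r; congr << _ >>.
apply/fsetP => j; rewrite in_symdiff !inE.
by case: eqP => // ->; rewrite (negPf nis).
Qed.

End Coefficients.

Section Standard.

Variables (R : comNzRingType) (d : Order.disp_t) (M : orderType d).
Variables (V : lmodType R) (e : M -> V) (he : is_basis e).

Notation W := {malg R[{fset M}]}.
Notation iW := (V_in_W he).
Notation wedge := (mulW (fun=> 0 : R)).

Lemma eq_linear_basis (U : lmodType R) (f g : V -> U) :
  linear f -> linear g -> (forall i, f (e i) = g (e i)) -> f =1 g.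
Proof.
move=> lf lg fg x.
pose fL := GRing.isLinear.Build R V U _ f lf.
pose F : {linear V -> U} := HB.pack f fL.
pose gL := GRing.isLinear.Build R V U _ g lg.
pose G : {linear V -> U} := HB.pack g gL.
rewrite -[f]/(F : V -> U) -[g]/(G : V -> U).
have [c <-] := basis_span he x; rewrite /lincomb !linear_sum.
by apply: eq_bigr => i _; rewrite !linearZ /= fg.
Qed.

Section DiagonalForm.

Variable B : {biscalar V}.
Hypothesis B_diag : forall i j : M, i != j -> B (e i) (e j) = 0.

Notation q := (fun i => B (e i) (e i)).

(** The contraction by [v] is an antiderivation of the outer product, written
    without the contraction.  All three arguments enter linearly, so the
    identity reduces to basis elements. *)
Lemma clifford_outer v a x :
  mulW q (iW v) (wedge (iW a) x) + wedge (iW a) (mulW q (iW v) x)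
  = B v a *: x.
Proof.
have lr := @mulW_linearr R d M; have ll := @mulW_linearl R d M.
move: v; apply: eq_linear_basis => [k u v|k u v|i].
- by rewrite linearP !ll lr scalerDr addrACA.
- by rewrite linearPl /= scalerDl scalerA.
move: a; apply: eq_linear_basis => [k u v|k u v|j].
- by rewrite linearP !ll lr scalerDr addrACA.
- by rewrite linearPr /= scalerDl scalerA.
move: x; apply: eq_linearW => [k u v|k u v|K].
- by rewrite !lr scalerDr addrACA.
- by rewrite scalerDr !scalerA mulrC.
rewrite !V_in_We clifford_outer_basis; congr (_ *: _).
by case: (eqVneq i j) => [-> //|/B_diag].
Qed.

End DiagonalForm.

Lemma outer_anticomm v a x :
  wedge (iW v) (wedge (iW a) x) = - wedge (iW a) (wedge (iW v) x).
Proof.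
apply/eqP; rewrite -addr_eq0.
have := clifford_outer (B := @zero_form R V) (fun _ _ _ => erefl) v a x.
by rewrite /= /zero_form scale0r => ->.
Qed.

Section OrthogonalProducts.

Variable B : {biscalar V}.
Hypothesis B_diag : forall i j : M, i != j -> B (e i) (e j) = 0.

Notation q := (fun i => B (e i) (e i)).

(** By [clifford_outer] and [outer_anticomm], both products by [v] pass a factor
    [a i] orthogonal to [v] with the same sign; past the last factor they both
    act on the unit and give [v]. *)
Lemma clifford_outer_prod p v (a : 'I_p -> V) :
  (forall i, B v (a i) = 0) ->
  let x := \big[wedge/oneW R M]_(i < p) iW (a i) in
  mulW q (iW v) x = wedge (iW v) x.
Proof.
elim: p a => [|p IHp] a va /=; first by rewrite big_ord0 !mulW1.
rewrite big_ord_recl outer_anticomm -IHp => [|i]; last exact: va.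
by apply/eqP; rewrite -addr_eq0 clifford_outer // va scale0r.
Qed.

Lemma prod_orthogonal p (a : 'I_p -> V) :
  (forall i j : 'I_p, i != j -> B (a i) (a j) = 0) ->
  \big[mulW q/oneW R M]_(i < p) iW (a i)
  = \big[wedge/oneW R M]_(i < p) iW (a i).
Proof.
elim: p a => [|p IHp] a aa; first by rewrite !big_ord0.
rewrite !big_ord_recl IHp => [|i j nij]; last first.
  by apply: aa; rewrite (inj_eq lift_inj).
by rewrite clifford_outer_prod // => i; apply: aa; exact: neq_lift.
Qed.

End OrthogonalProducts.

Section Transport.

Variables (U : lmodType R) (incl : {linear V -> U}).

Lemma iso_prod (B : {biscalar V}) (A : algebra_on U) (f : {linear W -> U})
    (J : Type) (s : seq J) (a : J -> V) :
  algebra_iso (W_form e B) A f -> fixes_V he incl f ->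
  f (\big[mulW (fun i => B (e i) (e i))/oneW R M]_(i <- s) iW (a i))
  = \big[amul A/aone A]_(i <- s) incl (a i).
Proof.
move=> [_ f1 fM] fV; rewrite (big_morph f fM f1).
by apply: eq_bigr => i _; rewrite fV.
Qed.

End Transport.

End Standard.

Theorem theorem4 (R : comNzRingType) (d : Order.disp_t) (M : orderType d)
    (V : lmodType R) (V_neq0 : exists v : V, v != 0)
    (e : M -> V) (he : is_basis e)
    (B : {biscalar V}) (B_diag : forall i j : M, i != j -> B (e i) (e j) = 0)
    (U : lmodType R) (incl : {linear V -> U}) (incl_inj : injective incl)
    (A : double_algebra U)
    (A_clifford : is_clifford he incl B (clifford_part A))
    (A_grassmann : is_grassmann he incl (outer_part A))
    (A_unit : aone (clifford_part A) = aone (outer_part A)) :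
  is_geometric he incl B A <->
  (forall (p : nat) (a : 'I_p -> V),
     (forall i j : 'I_p, i != j -> B (a i) (a j) = 0) ->
     aprod (clifford_part A) (fun i => incl (a i))
     = aprod (outer_part A) (fun i => incl (a i))).
Proof.
split=> [[f [fB f0 fV]] p a aa | prodE].
  rewrite /aprod -(iso_prod _ _ fB fV) -(iso_prod _ _ f0 fV).
  by rewrite prod_orthogonal.
have [f fB fV] := A_clifford; have [g g0 gV] := A_grassmann.
have fg : f =1 g.
  apply: eq_linearW => [||K]; [exact: linearP | exact: linearP |].
  have [c KE] := basisE_prod R (fset_uniq K).
  have {}KE q : << K >> = c *: \big[mulW q/oneW R M]_(i <- K) V_in_W he (e i).
    rewrite (eq_bigr _ (fun i _ => V_in_We he i)) -KE; congr << _ >>.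
    by apply/fsetP => i; rewrite !inE.
  rewrite [in LHS](KE (fun i => B (e i) (e i))) [in RHS](KE (fun=> 0)) !linearZ.
  congr (_ *: _); rewrite (iso_prod _ _ fB fV).
  rewrite [RHS](iso_prod _ _ g0 gV).
  (* The product condition speaks of families indexed by ordinals. *)
  rewrite big_tnth [RHS]big_tnth; apply: prodE => i j nij; apply: B_diag.
  by apply: contraNneq nij => /(tuple_uniqP (in_tuple K) (fset_uniq K)) ->.
exists f; split => //; case: g0 => _ g1 gM; split.
- by case: fB.
- by rewrite fg; exact: g1.
- by move=> x y; rewrite !fg; exact: gM.
Qed.
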